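(* Let $(\lambda_\alpha)_{\alpha\in(0,\alpha_1]}$ be drift rates such that $\mathcal{V}_\alpha=\mathcal{V}_0+\alpha\mathcal{M}$ is $(\lambda_\alpha,A'_\alpha)$-admissible for $\mathcal{L}_\alpha$ and $\lambda_\alpha\ge\lambda+\delta\alpha-C_\lambda\alpha^2$ for $\alpha\in(0,\alpha_1]$, with $\lambda_0:=\lambda$. Assume that $\widetilde\Lambda_{1,0}(\lambda)<\min\{\widetilde\Lambda_{2,0}(\lambda),\widetilde\Lambda_{3,0}(\lambda)\}$ and that $\alpha\mapsto\widetilde\Lambda_{i,\alpha}(\lambda_\alpha)$ is continuous on $[0,\alpha_1]$ for $i=1,2,3$. Suppose $$\delta>\gamma\lambda\qquad\text{and}\qquad\Lambda_0:=\frac{J_2L}{\lambda}>\frac12.$$ Let $c_\alpha:=\frac{\gamma}{384}\min_{i=1,2,3}\widetilde\Lambda_{i,\alpha}(\lambda_\alpha)$ (HFHR contraction rate) and $c_0:=\frac{\gamma}{384}\min_{i=1,2,3}\widetilde\Lambda_{i,0}(\lambda)$ (kinetic Langevin contraction rate), and let $\alpha_{\mathrm{global}}:=\min\{\alpha_{\mathrm{branch,acc}},\alpha_{\mathrm{metric,acc}}\}$. Then for all $\alpha\in(0,\alpha_{\mathrm{global}}]$ the HFHR dynamics achieves a strictly better contraction rate than the kinetic Langevin dynamics, namely $$c_\alpha\ge c_0+\kappa_{\mathrm{global}}\,\alpha,\qquad\kappa_{\mathrm{global}}:=\min\{\kappa,\,c_0c_2,\,c_0c_3\}>0.$$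
   Context: Fix an integer $d\ge1$, $\gamma>0$ and $\kappa_{\mathrm{adjust}}\in(0,1)$; $|\cdot|$ is the Euclidean norm, $\|\cdot\|_{\mathrm{op}}$ the operator norm; points of $\mathbb{R}^{2d}$ are $z=(q,p)$. Assumption 1 on $U:\mathbb{R}^d\to\mathbb{R}$: there are constants $L,A\in(0,\infty)$, $\lambda\in(0,1/4]$ such that (i) $U\in C^1$, $U\ge0$; (ii) $\nabla U$ is $L$-Lipschitz; (iii) $\frac12q\cdot\nabla U(q)\ge\lambda\left(U(q)+\frac{\gamma^2}{4}|q|^2\right)-A$ for all $q$. Put $\mathcal{V}_0(q,p)=U(q)+\frac{\gamma^2}{4}\left(|q+\gamma^{-1}p|^2+|\gamma^{-1}p|^2-\lambda|q|^2\right)$. Assumption 2: there are $C_{\mathrm{linear}}>0$, a symmetric positive definite $Q_\infty\in\mathbb{R}^{d\times d}$ and a nonincreasing $\varrho:[0,\infty)\to[0,\infty)$ with $\varrho(r)\to0$ as $r\to\infty$ and $|\nabla U(q)-Q_\infty q|\le\varrho(|q|)|q|$ for $|q|\ge C_{\mathrm{linear}}$. Generator of the HFHR dynamics: $\mathcal{L}_\alpha\varphi=(p-\alpha\nabla U)\cdot\nabla_q\varphi+(-\gamma p-\nabla U)\cdot\nabla_p\varphi+\alpha\Delta_q\varphi+\gamma\Delta_p\varphi$ ($\alpha=0$: kinetic Langevin dynamics). Put $\mathcal{A}_0:=p\cdot\nabla_q+(-\gamma p-\nabla U)\cdot\nabla_p$, $\mathcal{A}':=-\nabla U\cdot\nabla_q$.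 A function $\mathcal{V}:\mathbb{R}^{2d}\to[0,\infty)$, $C^2$ or $C^1$ with locally Lipschitz derivatives, is $(\ell,E)$-admissible for $\mathcal{L}_\alpha$ if $\mathcal{L}_\alpha\mathcal{V}\le\gamma(d+E-\ell\mathcal{V})$ a.e. Corrector: let $B=\begin{pmatrix}0&I_d\\-Q_\infty&-\gamma I_d\end{pmatrix}$, $B_1(q,p)=|Q_\infty q|^2+\frac{\gamma^2}{2}(1-\lambda)\langle Q_\infty q,q\rangle+\frac\gamma2\langle Q_\infty q,p\rangle-\left(\frac12|p|^2+\frac\gamma2\langle q,p\rangle+\frac12\langle(Q_\infty+\frac{\gamma^2}{2}(1-\lambda)I_d)q,q\rangle\right)$, $C_{B_1}=\nabla^2B_1$, $\mathsf{K}$ the unique symmetric solution of $B^\top\mathsf{K}+\mathsf{K}B=C_{B_1}$, with $d\times d$ blocks $\mathsf{K}_{qq},\mathsf{K}_{qp},\mathsf{K}_{pq},\mathsf{K}_{pp}$, and $\mathcal{M}(z)=\frac12z^\top\mathsf{K}z$. Constants: $a_{\min}=\lambda_{\min}(Q_\infty)+\frac{\gamma^2}{2}(1-\lambda)$, $a_{\max}=\lambda_{\max}(Q_\infty)+\frac{\gamma^2}{2}(1-\lambda)$, $\underline a=\frac14\left(a_{\min}+1-\sqrt{(a_{\min}-1)^2+\gamma^2}\right)$, $H=2(\|\mathsf{K}_{pq}\|_{\mathrm{op}}+\|\mathsf{K}_{pp}\|_{\mathrm{op}})+4\lambda_{\max}(Q_\infty)+\gamma^2|1-\lambda|+\gamma$,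 $\rho_\star=\frac12\left(-H+\sqrt{H^2+\frac54\underline a}\right)$; for $R\ge1$, $\rho_\nabla(R)=\sup_{|q|\ge R}\frac{|\nabla U(q)-Q_\infty q|}{|q|}$, $\delta_U(R)=\sup_{|q|\ge R}\frac{|U(q)-\frac12\langle Q_\infty q,q\rangle|}{1+|q|^2}$; $R_0=\inf\{R\ge\max\{1,C_{\mathrm{linear}}\}:\rho_\nabla(R)\le\rho_\star\}$; $$\underline c_{\mathrm{imp}}=\frac38\cdot\frac{a_{\min}+1-\sqrt{(a_{\min}-1)^2+\gamma^2}}{a_{\max}+1+\sqrt{(a_{\max}-1)^2+\gamma^2}+8\delta_U(R_0)},\quad C_{\mathrm{imp}}=\sup_{|q|\le R_0,\,p\in\mathbb{R}^d}\{\mathcal{A}_0\mathcal{M}+\mathcal{A}'\mathcal{V}_0+\underline c_{\mathrm{imp}}\mathcal{V}_0\}.$$ $\mu_{\min}=\frac18\left(\gamma^2(1-\lambda)+2-\sqrt{(\gamma^2(1-\lambda)-2)^2+4\gamma^2}\right)$, $c_1=\min(1,\mu_{\min})$, $C_{\mathcal{M}}=\frac12\|\mathsf{K}\|_{\mathrm{op}}$, $\widetilde C_{\mathcal{M}}=C_{\mathcal{M}}/c_1$, $C_1=C_{\mathrm{imp}}+\gamma\,\mathrm{tr}(\mathsf{K}_{pp})+dL+\frac{\gamma^2}{2}d|1-\lambda|$, $C_2=|\mathrm{tr}(\mathsf{K}_{qq})|+3C_{\mathcal{M}}\frac{L+|\nabla U(0)|}{c_1}$, $\delta=\underline c_{\mathrm{imp}}-\lambda\widetilde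 C_{\mathcal{M}}$, $C_\lambda=C_2+\widetilde C_{\mathcal{M}}\underline c_{\mathrm{imp}}$, $A'_\alpha=A+\frac\alpha\gamma[C_1+\alpha C_2+\widetilde C_{\mathcal{M}}(\lambda+\underline c_{\mathrm{imp}})]$, $\alpha_0=\frac{\gamma\lambda}{2}\left\{\frac1{c_1}\left[\frac{\gamma^4}{4}(1-\lambda)^2+\frac{\gamma^2}{4}\right]+Ld+\frac{\gamma^2}{2}d(1-\lambda)\right\}^{-1}$, $\alpha_1=\min\{\alpha_0,1,\frac{c_1}{2C_{\mathcal{M}}},\alpha_{\mathrm{pos}}\}$, where $\alpha_{\mathrm{pos}}>0$ is any constant with $\lambda+\delta\alpha-C_\lambda\alpha^2\ge\lambda/2$ on $(0,\alpha_{\mathrm{pos}}]$. Rate branches: $L_{\mathrm{eff}}(\alpha)=(1+\alpha\gamma)L$, $\theta_0=L\gamma^{-2}$, $J_2=\frac{12}{5}(1+2\theta_0+2\theta_0^2)\frac{d+A}{\gamma^2(1-2\lambda)}$, $h(x)=\sqrt xe^{-x}$, and for $\ell>0$: $\Lambda_\alpha(\ell)=J_2L_{\mathrm{eff}}(\alpha)/\ell$, $\widetilde\Lambda_{1,\alpha}(\ell)=\frac{\ell L_{\mathrm{eff}}(\alpha)}{\gamma^2}$, $\widetilde\Lambda_{2,\alpha}(\ell)=h(\Lambda_\alpha(\ell))\frac{L_{\mathrm{eff}}(\alpha)}{\gamma^2}$, $\widetilde\Lambda_{3,\alpha}(\ell)=\kappa_{\mathrm{adjust}}h(\Lambda_\alpha(\ell))$.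 Thresholds and gains. Lyapunov branch: $\alpha_{\mathrm{branch}}=\sup\{\alpha\in(0,\alpha_1]:\min\{\widetilde\Lambda_{2,\beta}(\lambda_\beta),\widetilde\Lambda_{3,\beta}(\lambda_\beta)\}>\widetilde\Lambda_{1,\beta}(\lambda_\beta)\ \forall\beta\in[0,\alpha]\}$, $\kappa=\frac{L(\delta+\gamma\lambda)}{768\gamma}$, $C'=\frac{L}{384\gamma}(1+\gamma)C_\lambda$, $\alpha_{\mathrm{branch,acc}}=\min\{\alpha_{\mathrm{branch}},1,\kappa/C'\}$. Metric branch: $D=\delta-\gamma\lambda$, $M_h=\sup_{x\in[\Lambda_0/2,\Lambda_0]}\left|\frac{x^2-x-1/4}{x^{3/2}}e^{-x}\right|$, $c_\Lambda=\frac{J_2LD}{8\lambda^2}$, $c_3$ any number in $\left(0,\frac12(1-\frac1{2\Lambda_0})c_\Lambda\right)$, $c_2=\gamma+c_3$, and $\alpha_{\mathrm{metric,acc}}=\min\left\{\alpha_1,1,\frac{D}{4C_\lambda},\sqrt{\frac{\lambda}{2C_\lambda}},\frac{4\lambda}{D},\frac{8\lambda^2\sqrt{\Lambda_0}e^{-\Lambda_0}(1-\frac1{2\Lambda_0})}{J_2LDM_h}\right\}$ (terms with $C_\lambda$ omitted if $C_\lambda=0$). *)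

(* Defs.v *)
From HB Require Import structures.
From mathcomp Require Import all_boot all_order all_algebra.
From mathcomp Require Import all_classical all_reals all_analysis.

Set Implicit Arguments.
Unset Strict Implicit.
Unset Printing Implicit Defensive.
Import Order.TTheory GRing.Theory Num.Theory.
Import numFieldNormedType.Exports.

Local Open Scope classical_set_scope.
Local Open Scope ring_scope.

(* Points of R^n are column vectors 'cV[R]_n. The library norm on matrices is
   the maximum norm (its topology is the usual one), so the Euclidean norm
   is introduced separately. *)
Section Euclidean.
Variables (R : realType) (n : nat).

Definition dot (x y : 'cV[R]_n) : R := \sum_i x i 0 * y i 0.

Definition enorm (x : 'cV[R]_n) : R := Num.sqrt (dot x x).

Definition opnorm (M : 'M[R]_n) : R :=
  sup [set enorm (M *m x) | x in [set x | enorm x <= 1]].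

Definition posdef (M : 'M[R]_n) : Prop :=
  M^T = M /\ forall x : 'cV[R]_n, x != 0 -> 0 < dot x (M *m x).

(* Only used for symmetric matrices, whose spectrum is real. *)
Definition lambda_min (M : 'M[R]_n) : R := inf [set a | eigenvalue M a].
Definition lambda_max (M : 'M[R]_n) : R := sup [set a | eigenvalue M a].

Definition basis_vec (i : 'I_n) : 'cV[R]_n := delta_mx i 0.

Definition grad (f : 'cV[R]_n -> R) (x : 'cV[R]_n) : 'cV[R]_n :=
  \col_i 'D_(basis_vec i) f x.

Definition hess (f : 'cV[R]_n -> R) (x : 'cV[R]_n) : 'M[R]_n :=
  \matrix_(i, j) 'D_(basis_vec j) (fun y => grad f y i 0) x.

Definition C1_fun (f : 'cV[R]_n -> R) : Prop :=
  (forall x, differentiable f x) /\ continuous (grad f).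

Definition C2_fun (f : 'cV[R]_n -> R) : Prop :=
  C1_fun f /\ forall i, C1_fun (fun x => grad f x i 0).

Definition loc_lipschitz_grad (f : 'cV[R]_n -> R) : Prop :=
  forall x, exists r k : R, 0 < r /\
    forall y y', enorm (y - x) < r -> enorm (y' - x) < r ->
      enorm (grad f y - grad f y') <= k * enorm (y - y').

(* The library has no Lebesgue measure on R^n: a null set is a set that, for
   every e > 0, is covered by countably many boxes of total volume <= e. *)
Definition lebesgue_null (N : set 'cV[R]_n) : Prop :=
  forall e : R, 0 < e -> exists a b : nat -> 'cV[R]_n,
    [/\ forall k i, a k i 0 <= b k i 0,
        N `<=` \bigcup_k [set x | forall i, a k i 0 <= x i 0 <= b k i 0] &
        (\sum_(0 <= k <oo) (\prod_i (b k i 0 - a k i 0))%:E <= e%:E)%E].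

Definition almost_everywhere (P : 'cV[R]_n -> Prop) : Prop :=
  lebesgue_null [set x | ~ P x].

End Euclidean.

(* The real constants and functions on which everything depends; what is
   assumed of them is stated in assumption1, assumption2 and corrector. *)
Record params (R : realType) (d : nat) := Params {
  gamma : R;
  kappa_adjust : R;
  pot : 'cV[R]_d -> R;          (* the potential U *)
  LU : R;                       (* the constants L, A, lambda *)
  AU : R;
  lam : R;
  Clinear : R;
  Qinf : 'M[R]_d;
  Kmat : 'M[R]_(d + d)          (* the corrector matrix K *)
}.

Section HFHR.
Variables (R : realType) (d : nat) (P : params R d).

Local Notation g := (gamma P).
Local Notation U := (pot P).
Local Notation L := (LU P).
Local Notation A := (AU P).
Local Notation l := (lam P).
Local Notation Q := (Qinf P).
Local Notation K := (Kmat P).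
Local Notation dU := (grad (pot P)).
(* A point (q, p) of R^2d is col_mx q p. *)
Local Notation qpart z := (usubmx (z : 'cV[R]_(d + d))).
Local Notation ppart z := (dsubmx (z : 'cV[R]_(d + d))).

Definition assumption1 : Prop :=
  [/\ 0 < L, 0 < A, 0 < l <= 4^-1 &
      [/\ C1_fun U,
          forall q, 0 <= U q,
          forall q q', enorm (dU q - dU q') <= L * enorm (q - q') &
          forall q, l * (U q + g ^+ 2 / 4 * enorm q ^+ 2) - A
                    <= 2^-1 * dot q (dU q)]].

Definition assumption2 : Prop :=
  [/\ 0 < Clinear P, posdef Q &
      exists varrho : R -> R,
        [/\ forall r, 0 <= r -> 0 <= varrho r,
            forall r s, 0 <= r -> r <= s -> varrho s <= varrho r,
            varrho r @[r --> +oo] --> (0 : R) &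
            forall q, Clinear P <= enorm q ->
              enorm (dU q - Q *m q) <= varrho (enorm q) * enorm q]].

Definition V0 (z : 'cV[R]_(d + d)) : R :=
  let q := qpart z in let p := ppart z in
  U q + g ^+ 2 / 4 * (enorm (q + g^-1 *: p) ^+ 2 + enorm (g^-1 *: p) ^+ 2
                      - l * enorm q ^+ 2).

Definition laplace_q (phi : 'cV[R]_(d + d) -> R) z : R :=
  \sum_(i < d) hess phi z (lshift d i) (lshift d i).

Definition laplace_p (phi : 'cV[R]_(d + d) -> R) z : R :=
  \sum_(i < d) hess phi z (rshift d i) (rshift d i).

Definition generator (alpha : R) (phi : 'cV[R]_(d + d) -> R) z : R :=
  dot (ppart z - alpha *: dU (qpart z)) (qpart (grad phi z))
  + dot (- g *: ppart z - dU (qpart z)) (ppart (grad phi z))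
  + alpha * laplace_q phi z + g * laplace_p phi z.

Definition A0_op (phi : 'cV[R]_(d + d) -> R) z : R :=
  dot (ppart z) (qpart (grad phi z))
  + dot (- g *: ppart z - dU (qpart z)) (ppart (grad phi z)).

Definition A'_op (phi : 'cV[R]_(d + d) -> R) z : R :=
  - dot (dU (qpart z)) (qpart (grad phi z)).

(* When the gradient is locally Lipschitz, the second derivatives occurring in
   the generator exist almost everywhere (Rademacher). *)
Definition admissible (alpha ell E : R) (V : 'cV[R]_(d + d) -> R) : Prop :=
  [/\ forall z, 0 <= V z,
      C2_fun V \/ (C1_fun V /\ loc_lipschitz_grad V) &
      almost_everywhere
        (fun z => generator alpha V z <= g * (d%:R + E - ell * V z))].

Definition Bmat : 'M[R]_(d + d) := block_mx 0 1%:M (- Q) (- g%:M).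

Definition B1 (z : 'cV[R]_(d + d)) : R :=
  let q := qpart z in let p := ppart z in
  enorm (Q *m q) ^+ 2 + g ^+ 2 / 2 * (1 - l) * dot (Q *m q) q
  + g / 2 * dot (Q *m q) p
  - (2^-1 * enorm p ^+ 2 + g / 2 * dot q p
     + 2^-1 * dot ((Q + (g ^+ 2 / 2 * (1 - l))%:M) *m q) q).

(* B1 is a quadratic form: its Hessian is constant. *)
Definition CB1 : 'M[R]_(d + d) := hess B1 0.

(* Under assumption2 and 0 < gamma, Bmat is Hurwitz, so K is unique. *)
Definition corrector : Prop := K^T = K /\ Bmat^T *m K + K *m Bmat = CB1.

Definition Mcor (z : 'cV[R]_(d + d)) : R := 2^-1 * dot z (K *m z).

Definition Valpha (alpha : R) (z : 'cV[R]_(d + d)) : R :=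
  V0 z + alpha * Mcor z.

Definition Kqq : 'M[R]_d := ulsubmx K.
Definition Kpq : 'M[R]_d := dlsubmx K.
Definition Kpp : 'M[R]_d := drsubmx K.

Definition a_min : R := lambda_min Q + g ^+ 2 / 2 * (1 - l).
Definition a_max : R := lambda_max Q + g ^+ 2 / 2 * (1 - l).

Definition a_low : R :=
  4^-1 * (a_min + 1 - Num.sqrt ((a_min - 1) ^+ 2 + g ^+ 2)).

Definition Hcst : R :=
  2 * (opnorm Kpq + opnorm Kpp) + 4 * lambda_max Q + g ^+ 2 * `|1 - l| + g.

Definition rho_star : R :=
  2^-1 * (- Hcst + Num.sqrt (Hcst ^+ 2 + 5 / 4 * a_low)).

(* The sets whose supremum or infimum is taken below are nonempty and bounded
   on the relevant side under the two assumptions (with 1 <= d and 0 < gamma). *)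
Definition rho_nabla (r : R) : R :=
  sup [set enorm (dU q - Q *m q) / enorm q | q in [set q | r <= enorm q]].

Definition delta_U (r : R) : R :=
  sup [set `|U q - 2^-1 * dot (Q *m q) q| / (1 + enorm q ^+ 2)
      | q in [set q | r <= enorm q]].

Definition R0 : R :=
  inf [set r | Num.max 1 (Clinear P) <= r /\ rho_nabla r <= rho_star].

Definition c_imp : R :=
  3 / 8 * ((a_min + 1 - Num.sqrt ((a_min - 1) ^+ 2 + g ^+ 2))
           / (a_max + 1 + Num.sqrt ((a_max - 1) ^+ 2 + g ^+ 2)
              + 8 * delta_U R0)).

Definition C_imp : R :=
  sup [set A0_op Mcor z + A'_op V0 z + c_imp * V0 z
      | z in [set z | enorm (qpart z) <= R0]].

Definition mu_min : R :=
  8^-1 * (g ^+ 2 * (1 - l) + 2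
          - Num.sqrt ((g ^+ 2 * (1 - l) - 2) ^+ 2 + 4 * g ^+ 2)).

Definition c1 : R := Num.min 1 mu_min.

Definition C_M : R := 2^-1 * opnorm K.
Definition tC_M : R := C_M / c1.

Definition C1 : R :=
  C_imp + g * \tr Kpp + d%:R * L + g ^+ 2 / 2 * d%:R * `|1 - l|.

Definition C2 : R := `|\tr Kqq| + 3 * C_M * ((L + enorm (dU 0)) / c1).

Definition delta : R := c_imp - l * tC_M.

Definition C_lambda : R := C2 + tC_M * c_imp.

Definition A'cst (alpha : R) : R :=
  A + alpha / g * (C1 + alpha * C2 + tC_M * (l + c_imp)).

Definition alpha0 : R :=
  g * l / 2 * (c1^-1 * (g ^+ 4 / 4 * (1 - l) ^+ 2 + g ^+ 2 / 4)
               + L * d%:R + g ^+ 2 / 2 * d%:R * (1 - l))^-1.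

Definition is_alpha_pos (apos : R) : Prop :=
  0 < apos /\ forall a, 0 < a <= apos ->
                l / 2 <= l + delta * a - C_lambda * a ^+ 2.

Definition alpha1 (apos : R) : R :=
  Num.min alpha0 (Num.min 1 (Num.min (c1 / (2 * C_M)) apos)).

Definition L_eff (alpha : R) : R := (1 + alpha * g) * L.
Definition theta0 : R := L * g ^- 2.
Definition J2 : R :=
  12 / 5 * (1 + 2 * theta0 + 2 * theta0 ^+ 2)
  * ((d%:R + A) / (g ^+ 2 * (1 - 2 * l))).
Definition hfun (x : R) : R := Num.sqrt x * expR (- x).

Definition Lambda (alpha ell : R) : R := J2 * L_eff alpha / ell.
Definition tLambda1 (alpha ell : R) : R := ell * L_eff alpha / g ^+ 2.
Definition tLambda2 (alpha ell : R) : R :=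
  hfun (Lambda alpha ell) * (L_eff alpha / g ^+ 2).
Definition tLambda3 (alpha ell : R) : R :=
  kappa_adjust P * hfun (Lambda alpha ell).

Definition contraction_rate (alpha ell : R) : R :=
  g / 384 * Num.min (tLambda1 alpha ell)
                    (Num.min (tLambda2 alpha ell) (tLambda3 alpha ell)).

Definition Lambda0 : R := J2 * L / l.

Section Thresholds.
Variables (apos : R) (rate : R -> R).

Definition alpha_branch : R :=
  sup [set a | 0 < a <= alpha1 apos /\
         forall b, 0 <= b <= a ->
           tLambda1 b (rate b)
             < Num.min (tLambda2 b (rate b)) (tLambda3 b (rate b))].

Definition kappa : R := L * (delta + g * l) / (768 * g).
Definition C' : R := L / (384 * g) * (1 + g) * C_lambda.

(* In both thresholds a term with denominator C_lambda is omitted when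
   C_lambda = 0. *)
Definition alpha_branch_acc : R :=
  let m := Num.min alpha_branch 1 in
  if C_lambda == 0 then m else Num.min m (kappa / C').

Definition Dgap : R := delta - g * l.

Definition M_h : R :=
  sup [set `|(x ^+ 2 - x - 4^-1) / (x `^ (3 / 2)) * expR (- x)|
      | x in `[Lambda0 / 2, Lambda0]].

Definition c_Lambda : R := J2 * L * Dgap / (8 * l ^+ 2).

Definition c2 (c3 : R) : R := g + c3.

Definition alpha_metric_acc : R :=
  let m :=
    Num.min (alpha1 apos) (Num.min 1 (Num.min (4 * l / Dgap)
      (8 * l ^+ 2 * Num.sqrt Lambda0 * expR (- Lambda0)
       * (1 - (2 * Lambda0)^-1) / (J2 * L * Dgap * M_h)))) in
  if C_lambda == 0 then m
  else Num.min m (Num.min (Dgap / (4 * C_lambda))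
                          (Num.sqrt (l / (2 * C_lambda)))).

Definition alpha_global : R := Num.min alpha_branch_acc alpha_metric_acc.

End Thresholds.
End HFHR.

(* Main.v *)
Require Import Defs.
From mathcomp Require Import all_boot all_order all_algebra.
From mathcomp Require Import all_classical all_reals all_analysis.
From mathcomp Require Import ring lra.
Import Order.TTheory GRing.Theory Num.Theory.
Import numFieldNormedType.Exports.
Local Open Scope classical_set_scope.
Local Open Scope ring_scope.

(** Up to [alpha_branch] the minimum of the three branches is the first one
    (at [alpha_branch] itself by left continuity), and the first branch is
    increasing in the drift rate.  The lower bound on the rate therefore gives
    [c_a >= c_0 + 2 kappa a - C' a^2], and [C' a <= kappa]. *)

(** A weak inequality survives the left limit. This is needed because [alpha_branch] is a supremum:
    the strict comparison of branches may degenerate to equality there. *)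
Lemma le_right_endpoint (R : realType) (a b : R) (f h : R -> R) :
  a < b -> {within `[a, b], continuous f} -> {within `[a, b], continuous h} ->
  (forall x, a <= x < b -> f x <= h x) -> f b <= h b.
Proof.
move=> ab /continuous_within_itvP-/(_ ab)[_ _ fb].
move=> /continuous_within_itvP-/(_ ab)[_ _ hb] le_fh.
apply: (ler_cvg_to fb hb); near=> x.
by apply: le_fh; apply/andP; split; [apply: ltW|]; near: x;
  [exact: nbhs_left_gt | exact: nbhs_left_lt].
Unshelve. all: by end_near. Qed.

(* If the set is unbounded or empty, the library sets [sup] to [0]. *)
Lemma sup_ge0 (R : realType) (S : set R) : (forall x, S x -> 0 <= x) -> 0 <= sup S.
Proof.
move=> S_ge0; have [[[x Sx] ubS]|nS] := pselect (has_sup S); last by rewrite sup_out.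
by apply: le_trans (S_ge0 x Sx) _; apply: ub_le_sup.
Qed.

Lemma opnorm_ge0 (R : realType) (n : nat) (M : 'M[R]_n) : 0 <= opnorm M.
Proof. by apply: sup_ge0 => _ [x _ <-]; apply: sqrtr_ge0. Qed.

Lemma hfun_gt0 (R : realType) (x : R) : 0 < x -> 0 < hfun x.
Proof. by move=> x_gt0; rewrite mulr_gt0 ?sqrtr_gt0 ?expR_gt0. Qed.

Section Constants.
Variables (R : realType) (d : nat) (P : params R d).
Hypotheses (gamma_gt0 : 0 < gamma P) (asm1 : assumption1 P).

(** In [mu_min] the square of [g ^+ 2 * (1 - l) + 2] exceeds the radicand by
    [4 * g ^+ 2 * (1 - 2 * l)], which is positive because [l <= 1 / 4]. *)
Lemma c1_gt0 : 0 < c1 P.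
Proof.
have [_ _ /andP[_ l4] _] := asm1.
rewrite /c1 lt_min ltr01 /= /mu_min; set g := gamma P; set l := lam P.
have g2 : 0 < g ^+ 2 by rewrite exprn_gt0.
have l4' : l <= 1 / 4 by rewrite div1r.
have gl : 0 < g ^+ 2 * (1 - 2 * l) by rewrite mulr_gt0//; lra.
have s_gt0 : 0 < g ^+ 2 * (1 - l) + 2.
  by rewrite ltr_wpDl// mulr_ge0 ?ltW//; lra.
rewrite mulr_gt0 ?invr_gt0// subr_gt0 -(ger0_norm (ltW s_gt0)) -sqrtr_sqr ltr_sqrt.
  nra.
by rewrite exprn_gt0.
Qed.

Lemma tC_M_ge0 : 0 <= tC_M P.
Proof. by rewrite /tC_M divr_ge0 ?(ltW c1_gt0)// /C_M mulr_ge0 ?opnorm_ge0. Qed.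

(** The sign of [c_imp] is read off from [c_imp = delta + lam * tC_M], so its defining formula with
    eigenvalues and suprema need not be examined. *)
Lemma C_lambda_ge0 : 0 <= delta P -> 0 <= C_lambda P.
Proof.
have [L_gt0 _ /andP[l_gt0 _] _] := asm1; rewrite /delta => delta_ge0.
have ltC : 0 <= lam P * tC_M P by rewrite mulr_ge0 ?tC_M_ge0 ?ltW.
have c_ge0 : 0 <= c_imp P by lra.
rewrite /C_lambda /C2 addr_ge0 ?(mulr_ge0 tC_M_ge0)// addr_ge0 ?normr_ge0//.
rewrite /C_M !mulr_ge0 ?opnorm_ge0 ?invr_ge0 ?(ltW c1_gt0)//.
by rewrite addr_ge0 ?sqrtr_ge0// ltW.
Qed.

Lemma J2_gt0 : 0 < J2 P.
Proof.
have [L_gt0 A_gt0 /andP[_ l4] _] := asm1.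
have l4' : lam P <= 1 / 4 by rewrite div1r.
have th : 0 < theta0 P by rewrite /theta0 mulr_gt0 ?invr_gt0 ?exprn_gt0.
have den : 0 < gamma P ^+ 2 * (1 - 2 * lam P).
  by rewrite mulr_gt0 ?exprn_gt0//; lra.
rewrite /J2 mulr_gt0 ?divr_gt0// ?ltr_wpDl ?ler0n//.
by rewrite mulr_gt0 ?divr_gt0//; nra.
Qed.

Let gamma384_gt0 : 0 < gamma P / 384.
Proof. by apply: divr_gt0 gamma_gt0 _; rewrite ltr0n. Qed.

Let L384_gt0 : 0 < LU P / (384 * gamma P).
Proof.
have [L_gt0 _ _ _] := asm1.
by apply: divr_gt0 L_gt0 _; rewrite pmulr_rgt0 ?ltr0n.
Qed.

Lemma contraction_rate0_gt0 : 0 < kappa_adjust P -> 0 < contraction_rate P 0 (lam P).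
Proof.
have [L_gt0 _ /andP[l_gt0 _] _] := asm1 => k_gt0.
have Le : 0 < L_eff P 0 by rewrite /L_eff mul0r addr0 mul1r.
have g2 : 0 < gamma P ^+ 2 by rewrite exprn_gt0.
have hL : 0 < hfun (Lambda P 0 (lam P)).
  by rewrite hfun_gt0// /Lambda divr_gt0// mulr_gt0// J2_gt0.
apply: (mulr_gt0 gamma384_gt0); rewrite !lt_min; apply/and3P; split.
- by rewrite /tLambda1 divr_gt0// mulr_gt0.
- by rewrite /tLambda2 mulr_gt0// divr_gt0.
- by rewrite /tLambda3 mulr_gt0.
Qed.

(** The minimum is at most its first entry. At [0] this upper bound suffices, since [c_0] only has
    to be bounded from above. *)
Lemma contraction_rate0_le :
  contraction_rate P 0 (lam P) <= LU P * lam P / (384 * gamma P).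
Proof.
have -> : LU P * lam P / (384 * gamma P) = gamma P / 384 * tLambda1 P 0 (lam P).
  by rewrite /tLambda1 /L_eff; field; rewrite lt0r_neq0.
by apply: (ler_wpM2l (ltW gamma384_gt0)); rewrite ge_min lexx.
Qed.

Lemma kappa_gt0 : 0 <= delta P -> 0 < kappa P.
Proof.
have [L_gt0 _ /andP[l_gt0 _] _] := asm1 => delta_ge0.
have s_gt0 : 0 < delta P + gamma P * lam P by rewrite ltr_wpDl// mulr_gt0.
have den_gt0 : 0 < 768 * gamma P by rewrite pmulr_rgt0 ?ltr0n.
exact: divr_gt0 (mulr_gt0 L_gt0 s_gt0) den_gt0.
Qed.

(** Expand [(1 + a * gamma) * (lam + delta * a - C_lambda * a ^+ 2)]: the linear coefficient
    [delta + gamma * lam] gives [2 * kappa], and for [a <= 1] the cubic loss is absorbed into the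
    quadratic one, whence the factor [1 + gamma] in [C']. *)
Lemma tLambda1_lower (a ell : R) : 0 <= delta P -> 0 <= a <= 1 ->
  lam P + delta P * a - C_lambda P * a ^+ 2 <= ell ->
  LU P * lam P / (384 * gamma P) + (2 * kappa P - C' P * a) * a
    <= gamma P / 384 * tLambda1 P a ell.
Proof.
have [L_gt0 _ /andP[l_gt0 _] _] := asm1 => delta_ge0 /andP[a_ge0 a_le1] le_ell.
have -> : LU P * lam P / (384 * gamma P) + (2 * kappa P - C' P * a) * a =
    LU P / (384 * gamma P) * (lam P + (delta P + gamma P * lam P) * a
      - (1 + gamma P) * C_lambda P * a ^+ 2).
  by rewrite /kappa /C'; field; rewrite lt0r_neq0.
have -> : gamma P / 384 * tLambda1 P a ell =
    LU P / (384 * gamma P) * ((1 + a * gamma P) * ell).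
  by rewrite /tLambda1 /L_eff; field; rewrite lt0r_neq0.
apply: (ler_wpM2l (ltW L384_gt0)).
have ag_ge0 : 0 <= a * gamma P by rewrite mulr_ge0 ?(ltW gamma_gt0).
apply: le_trans (_ : (1 + a * gamma P) *
  (lam P + delta P * a - C_lambda P * a ^+ 2) <= _); last first.
  by rewrite ler_wpM2l// addr_ge0.
(* The slack in the expansion is exactly the sum of the terms in [t1] and [t2]: the discarded
   quadratic gain, and the replacement of [a ^+ 3] by [a ^+ 2]. *)
have t1 : 0 <= a * gamma P * (delta P * a) by rewrite mulr_ge0// mulr_ge0.
have t2 : 0 <= gamma P * C_lambda P * a ^+ 2 * (1 - a).
  rewrite !mulr_ge0 ?subr_ge0 ?exprn_ge0 ?(ltW gamma_gt0)//.
  exact: C_lambda_ge0.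
rewrite -subr_ge0; apply: le_trans (addr_ge0 t1 t2) _.
by rewrite le_eqVlt; apply/orP; left; apply/eqP; ring.
Qed.

(** The threshold term [kappa / C'] is chosen so that the quadratic loss consumes at most half of
    the linear gain [2 * kappa]. When that term is omitted, [C_lambda = 0] makes [C'] vanish. *)
Lemma C'_mul_le_kappa (apos : R) (rate : R -> R) (a : R) : 0 <= delta P ->
  a <= alpha_branch_acc P apos rate -> C' P * a <= kappa P.
Proof.
have [L_gt0 _ _ _] := asm1 => delta_ge0.
rewrite /alpha_branch_acc; case: eqP => [C0 _|/eqP C0].
  by rewrite /C' C0 mulr0 mul0r ltW// kappa_gt0.
have C_gt0 : 0 < C_lambda P by rewrite lt_def C0 C_lambda_ge0.
rewrite !le_min => /andP[_]; rewrite ler_pdivlMr 1?mulrC//.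
have g1_gt0 : 0 < 1 + gamma P by rewrite addr_gt0.
exact: mulr_gt0 (mulr_gt0 L384_gt0 g1_gt0) C_gt0.
Qed.

Lemma alpha_branch_acc_le (apos : R) (rate : R -> R) (a : R) :
  a <= alpha_branch_acc P apos rate -> a <= alpha_branch P apos rate /\ a <= 1.
Proof.
rewrite /alpha_branch_acc; case: ifP => _; rewrite !le_min.
  by case/andP.
by case/andP=> /andP[].
Qed.

Lemma le_alpha_branch (apos : R) (rate : R -> R) (a : R) :
  0 < a <= alpha_branch P apos rate ->
  a <= alpha1 P apos /\
  forall b, 0 <= b < a -> tLambda1 P b (rate b) <
     Num.min (tLambda2 P b (rate b)) (tLambda3 P b (rate b)).
Proof.
rewrite /alpha_branch; set S := [set _ | _] => /andP[a_gt0 a_le].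
(* Otherwise [sup S] is [0] by default, against [0 < a <= sup S]. *)
have supS : has_sup S.
  by have [//|/sup_out S0] := pselect (has_sup S); move: a_le; rewrite S0 leNgt a_gt0.
split.
  by apply: le_trans a_le _; apply: ge_sup supS.1 _ => x [/andP[]].
(* Since [b] lies strictly below the supremum, some member [x] of [S] exceeds it, and membership of
   [x] gives the branch inequality on all of [[0, x]]. *)
move=> b /andP[b_ge0 b_lt]; have [x [_ Sx] bx] := sup_gt supS.1 (lt_le_trans b_lt a_le).
by apply: Sx; rewrite b_ge0 ltW.
Qed.

End Constants.

Theorem corollary4p13 (R : realType) (d : nat) (P : params R d)
    (alpha_pos c3 : R) (rate : R -> R)
    (hd : (1 <= d)%N)
    (hgamma : 0 < gamma P)
    (hkadj : 0 < kappa_adjust P < 1)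
    (hU : assumption1 P)
    (hQ : assumption2 P)
    (hK : corrector P)
    (hpos : is_alpha_pos P alpha_pos)
    (hadm : forall a, 0 < a <= alpha1 P alpha_pos ->
       admissible P a (rate a) (A'cst P a) (Valpha P a))
    (hrate : forall a, 0 < a <= alpha1 P alpha_pos ->
       lam P + delta P * a - C_lambda P * a ^+ 2 <= rate a)
    (hrate0 : rate 0 = lam P)
    (hbranch : tLambda1 P 0 (lam P)
       < Num.min (tLambda2 P 0 (lam P)) (tLambda3 P 0 (lam P)))
    (hcont1 : {within `[0, alpha1 P alpha_pos],
       continuous (fun a => tLambda1 P a (rate a))})
    (hcont2 : {within `[0, alpha1 P alpha_pos],
       continuous (fun a => tLambda2 P a (rate a))})
    (hcont3 : {within `[0, alpha1 P alpha_pos],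
       continuous (fun a => tLambda3 P a (rate a))})
    (hdelta : gamma P * lam P < delta P)
    (hLambda0 : 1 / 2 < Lambda0 P)
    (hc3 : 0 < c3 < 1 / 2 * (1 - (2 * Lambda0 P)^-1) * c_Lambda P) :
  let c_0 := contraction_rate P 0 (lam P) in
  let c_ a := contraction_rate P a (rate a) in
  let kappa_global :=
    Num.min (kappa P) (Num.min (c_0 * c2 P c3) (c_0 * c3)) in
  0 < kappa_global /\
  forall a, 0 < a <= alpha_global P alpha_pos rate ->
    c_0 < c_ a /\ c_0 + kappa_global * a <= c_ a.
Proof.
move=> c_0 c_ kg.
have [L_gt0 _ /andP[l_gt0 _] _] := hU.
have delta_ge0 : 0 <= delta P by rewrite ltW// (lt_trans _ hdelta)// mulr_gt0.
have c0_gt0 : 0 < c_0 by apply: contraction_rate0_gt0 => //; case/andP: hkadj.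
have c3_gt0 : 0 < c3 by case/andP: hc3.
have kg_gt0 : 0 < kg.
  rewrite !lt_min; apply/and3P; split; first exact: kappa_gt0.
    exact: mulr_gt0 c0_gt0 (addr_gt0 hgamma c3_gt0).
  exact: mulr_gt0 c0_gt0 c3_gt0.
split=> // a /andP[a_gt0]; rewrite le_min => /andP[a_acc _].
suff main : c_0 + kg * a <= c_ a.
  by split=> //; rewrite (lt_le_trans _ main)// ltrDl mulr_gt0.
have /alpha_branch_acc_le[a_branch a_le1] := a_acc.
have /le_alpha_branch[a_alpha1 branch] : 0 < a <= alpha_branch P alpha_pos rate.
  by rewrite a_gt0.
have sub : `[0, a] `<=` `[0, alpha1 P alpha_pos] by apply: subset_itvl.
(* [branch] covers only the points below [a]; continuity on [[0, a]] carries both comparisons to [a]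
   itself, so the first branch realises the minimum. *)
have -> : c_ a = gamma P / 384 * tLambda1 P a (rate a).
  rewrite /c_ /contraction_rate; congr (_ * _); apply/min_idPl; rewrite le_min.
  apply/andP; split.
  - apply: le_right_endpoint a_gt0 (continuous_subspaceW sub hcont1) (continuous_subspaceW sub hcont2) _ => x /branch.
    by rewrite lt_min => /andP[/ltW].
  - apply: le_right_endpoint a_gt0 (continuous_subspaceW sub hcont1) (continuous_subspaceW sub hcont3) _ => x /branch.
    by rewrite lt_min => /andP[_ /ltW].
have a01 : 0 <= a <= 1 by rewrite (ltW a_gt0).
have a0alpha1 : 0 < a <= alpha1 P alpha_pos by rewrite a_gt0.
apply: le_trans (tLambda1_lower _ _ _ hgamma hU _ _ delta_ge0 a01 (hrate _ a0alpha1)).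
(* Constant and linear parts are compared separately; the latter reduces to
   [kg <= kappa <= 2 * kappa - C' * a]. *)
apply: lerD; first exact: contraction_rate0_le.
rewrite ler_wpM2r ?(ltW a_gt0)//.
have : C' P * a <= kappa P by apply: C'_mul_le_kappa a_acc.
have : kg <= kappa P by rewrite ge_min lexx.
lra.
Qed.
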